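(* Let $S$ be a sequence of policy values in $V_6$. Then $$\delta\Bigl(\bigoplus\nolimits_{\mathbf{p\text{-}o}}^{V_6}(S)\Bigr) = \bigoplus\nolimits_{\mathbf{p\text{-}o}}^{\mathbf{P}}(\delta(S)).$$
   Context: $V_6 = \{\top_{\mathbf{p}}, \top_{\mathbf{d}}, I_{\mathbf{d}}, I_{\mathbf{p}}, I_{\mathbf{dp}}, \bot\}$ is a set of six distinct values (policy values). The set of pairwise policy values is $\mathbf{P} = \{[0,0], [\frac12,0], [0,\frac12], [\frac12,\frac12], [1,0], [0,1]\}$; for a pair write $d([D,P]) = D$ and $p([D,P]) = P$. Sequences are written $\langle s_1, \ldots, s_n\rangle$. The map $\delta : V_6 \to \mathbf{P}$ is: $\delta(\bot) = [0,0]$, $\delta(I_{\mathbf{d}}) = [\frac12,0]$, $\delta(I_{\mathbf{p}}) = [0,\frac12]$, $\delta(I_{\mathbf{dp}}) = [\frac12,\frac12]$, $\delta(\top_{\mathbf{d}}) = [1,0]$, $\delta(\top_{\mathbf{p}}) = [0,1]$. On sequences $\delta$ is applied elementwise: $\delta(\langle s_1,\dots,s_n\rangle) = \langle \delta(s_1), \dots, \delta(s_n)\rangle$. For a set $X \subseteq \mathbf{P}$, $\mathit{Max}(X) = [\max\{d(x) \mid x \in X\}, \max\{p(x) \mid x \in X\}]$, the componentwise maximum (a pair with entries in $\{0,\frac12,1\}$). Permit-overrides under $V_6$. Let $\sqsubseteq_{\mathbf{p\text{-}o}}$ be the lattice order on $V_6$ whose covering relations are: $\bot < I_{\mathbf{p}}$,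 $\bot < I_{\mathbf{d}}$, $I_{\mathbf{d}} < \top_{\mathbf{d}}$, $\top_{\mathbf{d}} < I_{\mathbf{dp}}$, $I_{\mathbf{p}} < I_{\mathbf{dp}}$, $I_{\mathbf{dp}} < \top_{\mathbf{p}}$. For a sequence $S = \langle s_1, \ldots, s_n\rangle$ in $V_6$, $\bigoplus_{\mathbf{p\text{-}o}}^{V_6}(S)$ is the least upper bound of $\{s_1, \ldots, s_n\}$ with respect to $\sqsubseteq_{\mathbf{p\text{-}o}}$. Permit-overrides under $\mathbf{P}$. For a sequence $S = \langle s_1, \ldots, s_n\rangle$ in $\mathbf{P}$ with $S' = \{s_1, \ldots, s_n\}$, $$\bigoplus\nolimits_{\mathbf{p\text{-}o}}^{\mathbf{P}}(S) = \begin{cases} [0,1] & \text{if } \mathit{Max}(S') = [D,1] \text{ for some } D, \\ [\frac12,\frac12] & \text{if } \mathit{Max}(S') = [D,\frac12] \text{ with } D \geq \frac12, \\ \mathit{Max}(S') & \text{otherwise.} \end{cases}$$ *)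

(* Defs.v *)
From HB Require Import structures.
From mathcomp Require Import all_boot all_order all_algebra.

Set Implicit Arguments.
Unset Strict Implicit.
Unset Printing Implicit Defensive.

Import Order.TTheory GRing.Theory Num.Theory.
Local Open Scope ring_scope.

Inductive V6 := Top_p | Top_d | I_d | I_p | I_dp | Bot.

Definition V6_code (x : V6) : nat :=
  match x with
  | Bot => 0 | I_d => 1 | I_p => 2 | I_dp => 3 | Top_d => 4 | Top_p => 5
  end.

Definition V6_decode (n : nat) : option V6 :=
  nth None (map some [:: Bot; I_d; I_p; I_dp; Top_d; Top_p]) n.

Fact V6_codeK : pcancel V6_code V6_decode.
Proof. by case. Qed.

HB.instance Definition _ := Countable.copy V6 (pcan_type V6_codeK).

Definition V6_enum : seq V6 := [:: Top_p; Top_d; I_d; I_p; I_dp; Bot].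

Fact V6_enumP : Finite.axiom V6_enum.
Proof. by case. Qed.

HB.instance Definition _ := isFinite.Build V6 V6_enumP.

(* [po_cover x y]: y covers x; the order is the reflexive-transitive closure
   of this relation. *)
Definition po_cover : rel V6 := fun x y =>
  match x, y with
  | Bot, I_p | Bot, I_d | I_d, Top_d | Top_d, I_dp | I_p, I_dp
  | I_dp, Top_p => true
  | _, _ => false
  end.

Definition po_le : rel V6 := connect po_cover.

Definition po_leb : rel V6 := fun x y =>
  match x, y with
  | Bot, _ | _, Top_p => true
  | I_d, (I_d | Top_d | I_dp) => true
  | I_p, (I_p | I_dp) => true
  | Top_d, (Top_d | I_dp) => true
  | I_dp, I_dp => true
  | _, _ => false
  end.

Lemma po_leE : po_le =2 po_leb.
Proof.
move=> x y; apply/idP/idP.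
  case/connectP=> p + ->; elim: p x => [|z p IHp] x /=; first by case: x.
  case/andP=> xz /IHp; move: xz; case: x; case: z => //=; by case: (last _ p).
have c1 u v : po_cover u v -> po_le u v by move/connect1.
have c2 u w v : po_cover u w -> po_le w v -> po_le u v.
  by move/c1; apply: connect_trans.
have c0 u : po_le u u by apply: connect0.
have dT := c1 I_dp Top_p isT.
have pT := c2 I_p I_dp Top_p isT dT.
have tT := c2 Top_d I_dp Top_p isT dT.
have pd := c1 I_p I_dp isT; have td := c1 Top_d I_dp isT.
have it := c1 I_d Top_d isT.
have id := c2 I_d Top_d I_dp isT td.
have iT := c2 I_d Top_d Top_p isT tT.
have b z : po_le I_d z -> po_le Bot z by apply: c2.
have b' z : po_le I_p z -> po_le Bot z by apply: c2.
by case: x; case: y => // _; auto.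
Qed.

Fact po_le_refl : reflexive po_le.
Proof. exact: connect0. Qed.

Fact po_le_anti : antisymmetric po_le.
Proof. by move=> x y; rewrite !po_leE; case: x; case: y. Qed.

Fact po_le_trans : transitive po_le.
Proof. exact: connect_trans. Qed.

Fact po_display : Order.disp_t.
Proof. exact: Order.Disp tt tt. Qed.

HB.instance Definition _ :=
  Order.Le_isPOrder.Build po_display V6 po_le_refl po_le_anti po_le_trans.

(* The only incomparable pairs are {I_p, I_d} and {I_p, Top_d}. *)
Definition po_meet (x y : V6) : V6 :=
  if po_leb x y then x else if po_leb y x then y else Bot.

Definition po_join (x y : V6) : V6 :=
  if po_leb x y then y else if po_leb y x then x else I_dp.

Fact po_meetP (x y z : V6) :
  (x <= po_meet y z)%O = ((x <= y)%O && (x <= z)%O).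
Proof.
by rewrite /Order.le /= !po_leE; case: x; case: y; case: z.
Qed.

Fact po_joinP (x y z : V6) :
  (po_join x y <= z)%O = ((x <= z)%O && (y <= z)%O).
Proof.
by rewrite /Order.le /= !po_leE; case: x; case: y; case: z.
Qed.

HB.instance Definition _ :=
  Order.POrder_MeetJoin_isLattice.Build po_display V6 po_meetP po_joinP.

Fact po_le0x (x : V6) : (Bot <= x)%O.
Proof. by rewrite /Order.le /= po_leE; case: x. Qed.

HB.instance Definition _ := Order.hasBottom.Build po_display V6 po_le0x.

(* Least upper bound of the set of values occurring in S; the empty sequence
   gives Bot. *)
Definition po_V6 (S : seq V6) : V6 := (\join_(s in S) s)%O.

Lemma po_V6_ub (S : seq V6) (s : V6) : s \in S -> (s <= po_V6 S)%O.
Proof. by move=> sS; apply: joins_sup. Qed.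

Lemma po_V6_least (S : seq V6) (u : V6) :
  (forall s : V6, s \in S -> (s <= u)%O) -> (po_V6 S <= u)%O.
Proof. by move=> Su; apply/joinsP. Qed.

(* The pair [D, P] is encoded as (D, P). *)
Definition pairwise_values : seq (rat * rat) :=
  [:: (0, 0); (1 / 2, 0); (0, 1 / 2); (1 / 2, 1 / 2); (1, 0); (0, 1)].

Definition PV : finType := seq_sub pairwise_values.

Definition dval (x : PV) : rat := (ssval x).1.
Definition pval (x : PV) : rat := (ssval x).2.

Definition delta (v : V6) : PV :=
  match v with
  | Bot => @SeqSub _ pairwise_values (0, 0) isT
  | I_d => @SeqSub _ pairwise_values (1 / 2, 0) isT
  | I_p => @SeqSub _ pairwise_values (0, 1 / 2) isT
  | I_dp => @SeqSub _ pairwise_values (1 / 2, 1 / 2) isT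
  | Top_d => @SeqSub _ pairwise_values (1, 0) isT
  | Top_p => @SeqSub _ pairwise_values (0, 1) isT
  end.

(* All entries are nonnegative, so the default 0 only matters for X = set0,
   where it makes the maximum (0, 0). The result need not lie in PV. *)
Definition Max (X : {set PV}) : rat * rat :=
  (\big[Num.max/0]_(x in X) dval x, \big[Num.max/0]_(x in X) pval x).

Definition po_P (S : seq PV) : rat * rat :=
  let M := Max [set s in S] in
  if M.2 == 1 then (0, 1)
  else if (M.2 == 1 / 2) && (1 / 2 <= M.1) then (1 / 2, 1 / 2)
  else M.

(* Main.v *)
Require Import Defs.
From mathcomp Require Import all_boot all_order all_algebra.

Import Order.TTheory.

(** The maximum of [delta S] determines the join of [S]: the two evolve together inside a nine-entry
    table, on which the claim is checked by computation. *)

(** Repetitions do not affect a maximum; the list form permits induction on [S]. *)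
Lemma bigmax_mem_seq d (R : orderType d) (I : finType) (x0 : R) (f : I -> R)
    (s : seq I) :
  (\big[Order.max/x0]_(i in [set j in s]) f i
   = \big[Order.max/x0]_(i <- s) f i)%O.
Proof.
by apply/le_anti/andP; split; apply: sub_bigmax_cond => i;
  rewrite !mem_filter !inE /= mem_index_enum andbT.
Qed.

(* The possible values of (Max (delta S), lub S). All pairs over {0, 1/2, 1}
   occur as componentwise maxima, including the three outside PV. *)
Definition max_lub_values : seq ((rat * rat) * V6) :=
  [seq (ssval (delta v), v) | v <- V6_enum] ++
  [:: ((1, 1 / 2), I_dp); ((1 / 2, 1), Top_p); ((1, 1), Top_p)]%R.

Lemma max_lub_mem (S : seq V6) :
  (Max [set x in [seq delta s | s <- S]], po_V6 S) \in max_lub_values.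
Proof.
rewrite /po_V6 -joins_seq /Max !bigmax_mem_seq !big_map.
elim: S => [|s S]; first by rewrite !big_nil.
rewrite !big_cons.
set D := bigop _ _ _; set P := bigop _ _ _; set j := bigop _ _ _.
(* The table is closed under adjoining any one value [s]. *)
have step : all (fun r => (Num.max (dval (delta s)) r.1.1,
    Num.max (pval (delta s)) r.1.2, po_join s r.2) \in max_lub_values)
  max_lub_values by case: s; vm_compute.
by move/(allP step).
Qed.

Theorem proposition2 (S : seq V6) :
  ssval (delta (po_V6 S)) = po_P [seq delta s | s <- S].
Proof.
rewrite /po_P; have := max_lub_mem S.
set M := Max _; set j := po_V6 S.
(* The rule of [po_P] alters only the three maxima outside [PV]. *)
have agree : all (fun r => ssval (delta r.2) ==
    (if r.1.2 == 1 then (0, 1)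
     else if (r.1.2 == 1 / 2) && (1 / 2 <= r.1.1) then (1 / 2, 1 / 2)
     else r.1)%R) max_lub_values by vm_compute.
by move/(allP agree)/eqP.
Qed.
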